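(* Let $c(x)=\tilde c(|x|)$ be identically zero or a strictly convex superlinear cost function on $\mathbb R^d$. Let $d\mu(x)=e^{-V(x)}dx$ be a probability measure on $\mathbb R^d$ such that, for all $x,y$ and some $\varepsilon>0$, $$\mathcal D_V(x,y)\le c(x-y)\quad\text{and}\quad \exp\big((3+\varepsilon)c(x-y)\big)\in L^1(\mu\otimes\mu).$$ Let $\psi:\mathbb R^+\to\mathbb R^+$ be strictly increasing. Assume in addition that for some $x_0\in\mathbb R^d$, $$\int_{\mathbb R^d}e^{\psi(|x-x_0|)}d\mu(x)\le K<\infty.$$ Then there exist $D,a_0>0$ such that every Borel set $A$ for which $a:=\min(\mu(A),\mu(A^c))$ satisfies $0<a\le a_0$ verifies $$D\,\mu^+(\partial A)\ge a\,\frac{\log\frac1a}{\psi^{-1}\left(\log\frac Ka\right)}.$$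
   Context: $|\cdot|$ is the Euclidean norm. $V$ is a differentiable function and $\mathcal D_V(x,y)=-\left(V(y)-V(x)-\langle\nabla V(x),y-x\rangle\right)$ is its convexity defect. A cost function is nonnegative and vanishes at $0$; superlinear means $c(x)/|x|\to\infty$ as $|x|\to\infty$. The boundary measure is the Minkowski content $\mu^+(\partial A)=\liminf_{h\to0^+}\frac1h\mu(\{x\in\mathbb R^d\setminus A:\ \mathrm{dist}(x,A)\le h\})$. If $\psi$ is not onto, $\psi^{-1}(s)$ denotes $\sup\{t\ge0:\psi(t)\le s\}$, and a quotient by $+\infty$ is $0$. *)

(* Defs.v *)
From HB Require Import structures.
From mathcomp Require Import all_boot all_order all_algebra.
From mathcomp Require Import all_classical all_reals all_analysis.
From mathcomp Require Import measurable_realfun.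

Set Implicit Arguments.
Unset Strict Implicit.
Unset Printing Implicit Defensive.

Import Order.TTheory GRing.Theory Num.Theory.
Import numFieldNormedType.Exports.

Local Open Scope classical_set_scope.
Local Open Scope ring_scope.

(* The library has no measurable structure on row vectors: the Borel
   sigma-algebra, generated by the open sets, is made the canonical one. *)
Section borel_rV.
Context (R : realType) (n : nat).

HB.instance Definition _ := @isMeasurable.Build
  (sigma_display (@open 'rV[R]_n)) 'rV[R]_n <<s (@open 'rV[R]_n) >>
  (@sigma_algebra0 _ setT (@open 'rV[R]_n))
  (@sigma_algebraC 'rV[R]_n (@open 'rV[R]_n))
  (@sigma_algebra_bigcup _ setT (@open 'rV[R]_n)).

End borel_rV.

Lemma open_measurable_rV (R : realType) (n : nat) (U : set 'rV[R]_n) :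
  open U -> measurable U.
Proof. by move=> oU; exact: sub_sigma_algebra. Qed.

Lemma measurable_coord_rV (R : realType) (n : nat) (j : 'I_n) :
  measurable_fun [set: 'rV[R]_n] (fun v : 'rV[R]_n => v ord0 j).
Proof.
apply: (measurability (@RGenOpens.G R)).
  exact: RGenOpens.measurableE.
move=> _ [_ [x [y ->]] <-].
rewrite setTI; apply: open_measurable_rV.
apply: open_comp; last exact: interval_open.
by move=> v _; exact: coord_continuous.
Qed.

Lemma measurable_fun_rVP (d : measure_display) (T : measurableType d)
    (R : realType) (n : nat) (f : T -> 'rV[R]_n) :
  (forall j, measurable_fun [set: T] (fun x => f x ord0 j)) ->
  measurable_fun [set: T] f.
Proof.
move=> mf; apply: (measurability (@open 'rV[R]_n)) => //.
move=> _ [U oU <-]; rewrite setTI.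
pose B (p : 'rV[rat]_n * nat) : set 'rV[R]_n := [set v | forall j,
  ball (ratr (p.1 ord0 j) : R) (p.2.+1%:R^-1) (v ord0 j)].
have UE : U = \bigcup_p (if `[< B p `<=` U >] then B p else set0).
  apply/seteqP; split => [v Uv|v [p _]]; last first.
    by case: ifPn => // /asboolP + Bv; exact.
  have : nbhs v U by exact: open_nbhs_nbhs.
  rewrite -nbhs_ballE => -[e /= e0 eU].
  have [k ke] : exists k, k.+1%:R^-1 < e / 2 :> R.
    exists (Num.truncn (2 / e)).
    rewrite invf_plt ?posrE ?divr_gt0// invf_div.
    exact: truncnS_gt.
  have k0 : (0 : R) < k.+1%:R^-1 by rewrite invr_gt0.
  have /choice[q qv] : forall j, exists q : rat,
      ball (v ord0 j) (k.+1%:R^-1) (ratr q : R).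
    move=> j.
    have [x [vx [r _ rx]]] : ball (v ord0 j) k.+1%:R^-1 `&` range ratr !=set0.
      apply: dense_rat; last exact: ball_open.
      by exists (v ord0 j); exact: ballxx.
    by exists r; rewrite rx.
  exists (\row_j q j, k) => //.
  case: ifPn => [_ j /=|/asboolPn nBU]; first by rewrite mxE; exact: ball_sym.
  exfalso; apply: nBU => w Bw; apply: eU; split => // i j; rewrite ord1.
  have := Bw j; rewrite /= mxE => qw.
  apply: (@le_ball _ _ _ (k.+1%:R^-1 + k.+1%:R^-1)).
    by rewrite (splitr e) lerD// ltW.
  exact: ball_triangle (qv j) qw.
rewrite UE preimage_bigcup; apply: countable_bigcupT_measurable.
  exact: countableP.
move=> p; case: ifPn => _; last by rewrite preimage_set0.
have -> : f @^-1` B p = \bigcap_(j in [set: 'I_n])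
    ((fun x => f x ord0 j) @^-1` ball (ratr (p.1 ord0 j) : R) p.2.+1%:R^-1).
  by apply/seteqP; split => [x Bx j _|x Bx j]; [exact: Bx|exact: (Bx j)].
apply: fin_bigcap_measurable => // j _.
by rewrite -[X in measurable X]setTI; apply: mf => //; exact: measurable_ball.
Qed.

Section lebesgue_rV_step.
Context (R : realType) (n : nat).

Definition cons_rV (p : R * 'rV[R]_n) : 'rV[R]_n.+1 :=
  \row_j oapp (fun k => p.2 ord0 k) p.1 (unlift ord0 j).

Definition uncons_rV (v : 'rV[R]_n.+1) : R * 'rV[R]_n :=
  (v ord0 ord0, \row_j v ord0 (lift ord0 j)).

Lemma cons_rVK : cancel cons_rV uncons_rV.
Proof.
move=> [x v]; rewrite /uncons_rV /cons_rV mxE unlift_none /=; congr pair.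
by apply/rowP => j; rewrite !mxE liftK.
Qed.

Lemma measurable_cons_rV : measurable_fun [set: R * 'rV[R]_n] cons_rV.
Proof.
apply: measurable_fun_rVP => j; rewrite /cons_rV.
under eq_fun do rewrite mxE.
case: unliftP => [k _|_] /=; last exact: measurable_fst.
exact: (measurableT_comp (measurable_coord_rV k) measurable_snd).
Qed.

Lemma measurable_uncons_rV : measurable_fun [set: 'rV[R]_n.+1] uncons_rV.
Proof.
apply/measurable_fun_pairP; split => /=; first exact: measurable_coord_rV.
apply: measurable_fun_rVP => j /=.
by under eq_fun do rewrite mxE; exact: measurable_coord_rV.
Qed.

Variable m : {sigma_finite_measure set 'rV[R]_n -> \bar R}.

Definition cons_measure : set 'rV[R]_n.+1 -> \bar R :=
  pushforward (@lebesgue_measure R \x m)%E cons_rV.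

Let cons_measure0 : cons_measure set0 = 0%E.
Proof. by rewrite /cons_measure /pushforward preimage_set0 measure0. Qed.

Let cons_measure_ge0 A : (0 <= cons_measure A)%E.
Proof. by rewrite /cons_measure /pushforward measure_ge0. Qed.

Let cons_measure_sigma_additive : semi_sigma_additive cons_measure.
Proof.
apply: measure_semi_sigma_additive; exact: measurable_cons_rV.
Qed.

HB.instance Definition _ := isMeasure.Build _ _ _ cons_measure
  cons_measure0 cons_measure_ge0 cons_measure_sigma_additive.

(* On m1 \x m2 the library's sigma-finite instance is hidden by the one for
   subprobabilities, hence this direct argument. *)
Let sigma_finite_cons_measure : sigma_finite setT cons_measure.
Proof.
have /sigma_finiteP[F [TF ndF Foo]] := sigma_finiteT (@lebesgue_measure R).
have /sigma_finiteP[G [TG ndG Goo]] := sigma_finiteT m.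
exists (fun k => uncons_rV @^-1` (F k `*` G k)) => [|k].
  rewrite -preimage_bigcup [X in _ @^-1` X](_ : _ = setT) ?preimage_setT//.
  apply/seteqP; split => // -[x v] _.
  have [i _ Fix] : (\bigcup_i F i) x by rewrite -TF.
  have [j _ Gjv] : (\bigcup_i G i) v by rewrite -TG.
  exists (maxn i j) => //; split => /=.
  - by move: x Fix; exact/subsetPset/ndF/leq_maxl.
  - by move: v Gjv; exact/subsetPset/ndG/leq_maxr.
have [mF Foo_k] := Foo k; have [mG Goo_k] := Goo k; split.
  rewrite -[X in measurable X]setTI; apply: measurable_uncons_rV => //.
  exact: measurableX.
rewrite /cons_measure /pushforward -comp_preimage.
rewrite (_ : _ \o _ = id) ?preimage_id//; last first.
  by apply/funext => p; exact: cons_rVK.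
by rewrite product_measure1E// lte_mul_pinfty// ge0_fin_numE.
Qed.

HB.instance Definition _ := Measure_isSigmaFinite.Build _ _ _ cons_measure
  sigma_finite_cons_measure.

End lebesgue_rV_step.

(* The n-fold product of the one-dimensional Lebesgue measure; lebesgue_rV_prod
   below determines it on boxes. *)
Fixpoint lebesgue_rV (R : realType) (n : nat) :
    {sigma_finite_measure set 'rV[R]_n -> \bar R} :=
  match n with
  | 0 => \d_(0 : 'rV[R]_0)
  | n'.+1 => cons_measure (lebesgue_rV R n')
  end.

Lemma lebesgue_rV_prod (R : realType) (n : nat) (I : 'I_n -> set R) :
  (forall j, measurable (I j)) ->
  lebesgue_rV R n [set v | forall j, I j (v ord0 j)] =
  (\prod_j lebesgue_measure (I j))%E.
Proof.
elim: n I => [|n IHn] I mI /=.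
  rewrite big_ord0 diracE mem_set//.
  by move=> [].
pose J : set 'rV[R]_n :=
  [set v | forall j, I (lift ord0 j) (v ord0 j)].
have mJ : measurable J.
  rewrite (_ : J = \bigcap_(j in [set: 'I_n])
      ((fun v : 'rV[R]_n => v ord0 j) @^-1` I (lift ord0 j))); last first.
    by apply/seteqP; split => [x Bx j _|x Bx j]; [exact: Bx|exact: (Bx j)].
  apply: fin_bigcap_measurable => // j _.
  by rewrite -[X in measurable X]setTI; apply: measurable_coord_rV.
rewrite /cons_measure /pushforward [X in (_ \x _)%E X](_ : _ = I ord0 `*` J).
  rewrite product_measure1E//; last exact: mI.
  by rewrite big_ord_recl; congr (_ * _)%E; exact: IHn.
apply/seteqP; split => [[x v] /= h|[x v] /= [Ix Jv] j].
  split; first by have := h ord0; rewrite mxE unlift_none.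
  by move=> j; have := h (lift ord0 j); rewrite mxE liftK.
by rewrite mxE; case: unliftP => [k|] ->.
Qed.

Section euclidean.
Context (R : realType) (n : nat).
Implicit Types (x y : 'rV[R]_n) (c V : 'rV[R]_n -> R) (A : set 'rV[R]_n).

Definition dotv x y : R := \sum_j x ord0 j * y ord0 j.

(* The norm `|x| carried by 'rV[R]_n in the library is the sup norm, so the
   Euclidean one is introduced separately; the topologies agree. *)
Definition enorm x : R := Num.sqrt (dotv x x).

Definition gradient V x : 'rV[R]_n := \row_j 'D_(delta_mx ord0 j) V x.

Definition convexity_defect V x y : R :=
  - (V y - V x - dotv (gradient V x) (y - x)).

Definition cost_function c := (forall x, 0 <= c x) /\ c 0 = 0.

Definition strictly_convex c := forall x y (t : R), x != y -> 0 < t < 1 ->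
  c (t *: x + (1 - t) *: y) < t * c x + (1 - t) * c y.

Definition superlinear c := forall M : R, exists r : R, forall x,
  r < enorm x -> M <= c x / enorm x.

(* Euclidean, unlike the library's edist_inf; equal to +oo when A is empty. *)
Definition edist_set x A : \bar R :=
  ereal_inf [set (enorm (x - y))%:E | y in A].

Definition minkowski_content (mu : set 'rV[R]_n -> \bar R) A : \bar R :=
  limf_einf (fun h : R =>
    ((h^-1)%:E * mu [set x | ~ A x /\ edist_set x A <= h%:E])%E) 0^'+.

End euclidean.

(* Extended-real valued: the value is +oo when psi is bounded by s. *)
Definition generalized_inverse (R : realType) (psi : R -> R) (s : R) : \bar R :=
  ereal_sup [set t%:E | t in [set t : R | 0 <= t /\ psi t <= s]].

(* Main.v *)
Require Import Defs.
From HB Require Import structures.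
From mathcomp Require Import all_boot all_order all_algebra.
From mathcomp Require Import all_classical all_reals all_analysis.
From mathcomp Require Import measurable_realfun ring lra.

Set Implicit Arguments.
Unset Strict Implicit.
Unset Printing Implicit Defensive.

Import Order.TTheory GRing.Theory Num.Theory.
Import numFieldNormedType.Exports.

Local Open Scope classical_set_scope.
Local Open Scope ring_scope.

(** A set [E] of small measure is contracted slightly towards a fixed cube [B],
    and a Prékopa-Leindler inequality bounds from below the measure of what is
    swept.

    Let [z = (1 - t) x + t y].  Writing the bound on the convexity defect from
    [z] to [x] and from [z] to [y], the gradient terms cancel, and
    [c (s w) <= s c w] for [0 <= s <= 1] leaves
      [V z <= (1 - t) V x + t V y + 2 t (1 - t) c (x - y)]
    ([potential_semiconvex]).  The cost couples [x] and [y]; it is decoupled by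
    an integrable weight [W] with [exp (p c (x - y)) <= W x] for all [y] in [B],
    where [p = 3 + eps] ([cost_weight]).  The Prékopa-Leindler inequality, whose
    second function may be taken constant on the cube ([cube_ineq]), then yields
    [cube_expansion]: if [E] is bounded and [a = mu E], then
      [mu ((1 - t) E + t B) >= a (1 + t ((1 - 2 / p) ln (1 / a) - const))].
    The factor [2 / p] comes from the entropy inequality
    [p * (mean of c over E) <= ln (C / a)], [C] being the integral of [W]; the
    logarithm has a positive coefficient because [p > 2].

    If [E] lies in the ball of radius [r], each point moves by at most [3 r t],
    so that the gain per unit of distance is of order [a ln (1 / a) / r].  An
    unbounded [E] is cut by a ball, which creates new boundary; among the radii
    between [r] and [2 r] at mutual distance [h], one creates a layer of mass
    at most [2 a h / r], negligible against [a ln (1 / a) h / r] when [a] is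
    small ([neighbourhood_gain]).  The moment hypothesis allows [r] to be twice
    [psi^-1 (ln (K / a))] ([exponential_tail]): the mass outside is at most
    [a / 4], not merely [a], since the tail of a convergent integral is small.

    When [A] is the smaller of [A] and its complement, take [E = A].  Otherwise
    take for [E] the points at distance more than [h] from [A]: its
    [h]-neighbourhood stays in the complement of [A], so that what it gains is
    part of the [h]-neighbourhood of [A]. *)

(** * Affine substitution on the line *)

Section affine.
Context (R : realType).
Notation mu := (@lebesgue_measure R).

Lemma lebesgue_measure_affine (u v : R) (A : set R) : 0 < u -> measurable A ->
  mu ((fun x => u * x + v) @^-1` A) = (u^-1%:E * mu A)%E.
Proof.
move=> u0 mA.
pose phi (x : measurableTypeR R) : measurableTypeR R := u * x + v.
have mphi : measurable_fun setT phi.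
  by apply: measurable_funD => //; apply: measurable_funM.
pose phi_mixin := isMeasurableFun.Build _ _ _ _ _ mphi.
pose phi_mfun : {mfun _ >-> _} := HB.pack phi phi_mixin.
pose u' : {nonneg R} := NngNum (ltW u0).
rewrite (@lebesgue_measure_unique _ (mscale u' (pushforward mu phi_mfun)) _ A mA).
  by rewrite /mscale/= /pushforward muleA -EFinM mulVf ?gt_eqF// mul1e.
move=> X [[a b] /= ab <-]; rewrite /mscale/= /pushforward.
rewrite (_ : phi @^-1` `]a, b] = `](a - v) / u, (b - v) / u]%classic); last first.
  apply/seteqP; split => x /=; rewrite !in_itv/= /phi.
    by rewrite ltr_pdivrMr// ler_pdivlMr// ltrBlDr lerBrDr (mulrC u).
  by rewrite ltr_pdivrMr// ler_pdivlMr// ltrBlDr lerBrDr (mulrC u).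
rewrite !lebesgue_measure_itv/= !lte_fin ltr_pM2r ?invr_gt0// ltrD2r.
case: ifPn => _; last by rewrite mule0.
by rewrite -!EFinB -EFinM; congr (_%:E); field; rewrite gt_eqF.
Qed.

Lemma ge0_integral_affine (u v : R) (D : set R) (g : R -> \bar R) : 0 < u ->
  measurable D -> measurable_fun setT g -> (forall x, 0 <= g x)%E ->
  (\int[mu]_(x in (fun x => u * x + v)%R @^-1` D) g (u * x + v)%R =
   u^-1%:E * \int[mu]_(x in D) g x)%E.
Proof.
move=> u0 mD mg g0.
pose phi (x : measurableTypeR R) : measurableTypeR R := u * x + v.
have mphi : measurable_fun setT phi.
  by apply: measurable_funD => //; apply: measurable_funM.
have u'0 : 0 <= u^-1 by rewrite invr_ge0 ltW.
pose u' : {nonneg R} := NngNum u'0.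
transitivity (\int[pushforward mu phi]_(x in D) g x)%E.
  by rewrite (ge0_integral_pushforward mphi)//; exact: measurable_funTS.
rewrite (@eq_measure_integral _ (measurableTypeR R) _ D (mscale u' mu)); last first.
  by move=> B mB BD; exact: lebesgue_measure_affine.
by rewrite ge0_integral_mscale//; exact: measurable_funTS.
Qed.

End affine.

(** * Prékopa-Leindler inequality against a cube *)

Lemma powR_amgm (R : realType) (t a b : R) : 0 < t < 1 -> 0 <= a -> 0 <= b ->
  a `^ (1 - t) * b `^ t <= (1 - t) * a + t * b.
Proof.
move=> /andP[t0 t1] a0 b0; have u0 : 0 < 1 - t by rewrite subr_gt0.
have := @conjugate_powR R (a `^ (1 - t)) (b `^ t) (1 - t)^-1 t^-1.
rewrite -!powRrM !mulfV ?gt_eqF// !powRr1// !invrK => /(_ _ _ _ _ _).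
rewrite (mulrC a) (mulrC b); apply; rewrite ?powR_ge0 ?invr_gt0//.
by rewrite subrK.
Qed.

Section cube_line.
Context (R : realType).
Notation mu := (@lebesgue_measure R).

(** Cut the line at [x].  The part of [F] to the left of [x] is contracted with
    [y = - rho], the part to the right with [y = rho], and the images leave free
    an interval of length [2 t rho], covered by the images of [x] itself.  On the
    three pieces [H] dominates [k F `^ (1 - t)], and [F <= m] turns this power
    into a multiple of [F].  Since the second function is the indicator of an
    interval, this replaces the level sets of the usual proof. *)
Lemma cube_line_peak (t rho k m x : R) (F : R -> R) (H : R -> \bar R) :
  0 < t < 1 -> 0 < rho -> 0 <= k -> 0 < m ->
  measurable_fun setT F -> (forall x, 0 <= F x <= m) ->
  measurable_fun setT H -> (forall x, 0 <= H x)%E ->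
  (forall x y, `|y| <= rho ->
    ((k * F x `^ (1 - t))%:E <= H ((1 - t) * x + t * y)%R)%E) ->
  (((1 - t) * k * m `^ (- t))%:E * \int[mu]_x (F x)%:E
    + (k * (t * (2 * rho)) * F x `^ (1 - t))%:E <= \int[mu]_x H x)%E.
Proof.
move=> /andP[t0 t1] rho0 k0 m0 mF F0m mH H0 FH.
have u0 : 0 < 1 - t by rewrite subr_gt0.
pose a := (1 - t) * x + - (t * rho); pose b := (1 - t) * x + t * rho.
have ab : a <= b by rewrite /a /b lerD2l; nra.
pose g x := (k * m `^ (- t) * F x)%:E.
have mg : measurable_fun setT g.
  by apply/measurable_EFinP; exact: measurable_funM.
have Fpow x' : k * m `^ (- t) * F x' <= k * F x' `^ (1 - t).
  rewrite -mulrA ler_wpM2l//; have /andP[F0 Fm] := F0m x'.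
  move: F0; rewrite le_eqVlt => /predU1P[<-|F0]; first by rewrite mulr0 powR_ge0.
  rewrite (addrC 1) powRD; last by apply/implyP => _; rewrite gt_eqF.
  rewrite powRr1 ?(ltW F0)// ler_wpM2r ?(ltW F0)//.
  rewrite !powRN lef_pV2 ?posrE ?powR_gt0//.
  by apply: ge0_ler_powR; rewrite ?nnegrE ?(ltW t0) ?(ltW F0) ?(ltW m0).
have g0 x' : (0 <= g x')%E.
  have /andP[? _] := F0m x'.
  by rewrite lee_fin !mulr_ge0// powR_ge0.
have piece (v : R) (D E : set R) : measurable D -> measurable E ->
    (fun x => (1 - t) * x + t * v) @^-1` D = E -> `|v| <= rho ->
    ((1 - t)%:E * \int[mu]_(x in E) g x <= \int[mu]_(x in D) H x)%E.
  move=> mD mE DE vrho; have := ge0_integral_affine (t * v) u0 mD mH H0.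
  rewrite DE => /(congr1 (fun z => (1 - t)%:E * z)%E).
  rewrite muleA -EFinM mulfV ?gt_eqF// mul1e => <-.
  apply: lee_wpmul2l; first by rewrite lee_fin ltW.
  apply: ge0_le_integral => //.
  - exact: measurable_funTS.
  - apply: measurable_funTS; apply: (measurableT_comp mH).
    by apply: measurable_funD => //; apply: measurable_funM.
  by move=> z _; apply: (le_trans _ (FH _ _ vrho)); rewrite lee_fin.
have left : ((1 - t)%:E * \int[mu]_(x in `]-oo, x]) g x <=
             \int[mu]_(x in `]-oo, a]) H x)%E.
  apply: (piece (- rho)) => //; last by rewrite normrN gtr0_norm.
  apply/seteqP; split => z; rewrite /= !in_itv/= /a mulrN lerD2r ler_pM2l//.
have right : ((1 - t)%:E * \int[mu]_(x in `]x, +oo[) g x <=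
             \int[mu]_(x in `]b, +oo[) H x)%E.
  apply: (piece rho) => //; last by rewrite gtr0_norm.
  by apply/seteqP; split => z; rewrite /= !in_itv/= /b !andbT ltrD2r ltr_pM2l.
have mid : ((k * (t * (2 * rho)) * F x `^ (1 - t))%:E <=
    \int[mu]_(x in `]a, b]) H x)%E.
  have -> : (k * (t * (2 * rho)) * F x `^ (1 - t))%:E =
      (\int[mu]_(z in `]a, b]) (k * F x `^ (1 - t))%:E)%E.
    rewrite integral_cst//= lebesgue_measure_itv/= lte_fin.
    rewrite (_ : a < b); last by rewrite /a /b ltrD2l; nra.
    by rewrite -EFinB -EFinM /a /b; congr (_%:E); ring.
  apply: ge0_le_integral => //.
  - by move=> *; rewrite lee_fin mulr_ge0// powR_ge0.
  - exact: measurable_funTS.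
  move=> z; rewrite /= in_itv/= /a /b => /andP[az zb].
  rewrite (_ : z = (1 - t) * x + t * ((z - (1 - t) * x) / t)); last first.
    by field; rewrite gt_eqF.
  apply: FH; rewrite ler_norml ler_pdivrMr// ler_pdivlMr//.
  by apply/andP; split; nra.
have splitT (c : R) (f : R -> \bar R) : measurable_fun setT f ->
    (forall x, 0 <= f x)%E -> (\int[mu]_x f x =
      \int[mu]_(x in `]-oo, c]) f x + \int[mu]_(x in `]c, +oo[) f x)%E.
  move=> mf f0; rewrite -ge0_integral_setU//=.
  - rewrite -setCitvl setUv//.
  - by rewrite -setCitvl setUv.
  - by apply/disj_setPS => z [] /=; rewrite !in_itv/= andbT => zc /lt_geF; rewrite zc.
have HE : (\int[mu]_x H x = \int[mu]_(x in `]-oo, a]) H x +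
    (\int[mu]_(x in `]a, b]) H x + \int[mu]_(x in `]b, +oo[) H x))%E.
  rewrite (splitT a)//; congr (_ + _)%E; rewrite -ge0_integral_setU//=.
  - by rewrite -itv_bndbnd_setU.
  - exact: measurable_funTS.
  - apply/disj_setPS => z [] /=; rewrite !in_itv/= andbT.
    by move=> /andP[_ zb] /lt_geF; rewrite zb.
rewrite HE addeCA addeC; apply: leeD => //.
apply: le_trans (leeD left right).
rewrite -muleDr; last 2 first.
- by [].
- by apply: ge0_adde_def; rewrite inE; apply: integral_ge0.
rewrite -splitT// (_ : (\int[mu]_x g x =
    (k * m `^ (- t))%:E * \int[mu]_x (F x)%:E)%E).
  by rewrite muleA -EFinM mulrA.
rewrite -ge0_integralZl//.
- exact/measurable_EFinP.
- by move=> z _; rewrite lee_fin; have /andP[] := F0m z.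
- by rewrite lee_fin mulr_ge0// powR_ge0.
Qed.

(** Let [x] approach the supremum of [F] in [cube_line_peak] and conclude by the
    arithmetic-geometric inequality. *)
Lemma cube_line_ineq (t rho k I : R) (F : R -> R) (H : R -> \bar R) :
  0 < t < 1 -> 0 < rho -> 0 <= k ->
  measurable_fun setT F -> (forall x, 0 <= F x) -> (exists C, forall x, F x <= C) ->
  (\int[mu]_x (F x)%:E = I%:E)%E ->
  measurable_fun setT H -> (forall x, 0 <= H x)%E ->
  (forall x y, `|y| <= rho ->
    ((k * F x `^ (1 - t))%:E <= H ((1 - t) * x + t * y)%R)%E) ->
  ((k * (2 * rho) `^ t * I `^ (1 - t))%:E <= \int[mu]_x H x)%E.
Proof.
move=> t01 rho0 k0 mF F0 [C FC] FI mH H0 FH; have /andP[t0 t1] := t01.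
have u0 : 0 < 1 - t by rewrite subr_gt0.
have I0 : 0 <= I.
  by rewrite -lee_fin -FI; apply: integral_ge0 => x _; rewrite lee_fin.
have [[x1 Fx1]|/forallNP F00] := pselect (exists x, 0 < F x); last first.
  have FE x : F x = 0 by apply/eqP; rewrite eq_le F0 andbT leNgt; exact/negP.
  have -> : I = 0.
    by apply: EFin_inj; rewrite -FI; apply: integral0_eq => x _; rewrite FE.
  by rewrite powR0 ?gt_eqF// mulr0; exact: integral_ge0.
pose m := sup (range F).
have supF : has_sup (range F).
  by split; [exists (F x1), x1|exists C => _ [x _ <-]; exact: FC].
have Fm x : F x <= m by apply: sup_upper_bound => //; exists x.
have m0 : 0 < m := lt_le_trans Fx1 (Fm x1).
have mpow : m `^ (1 - t) * m^-1 = m `^ (- t).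
  rewrite -powR_inv1 ?ltW// -powRD; last by apply/implyP => _; rewrite gt_eqF.
  by rewrite addrAC subrr add0r.
set Y := k * (t * (2 * rho)) * m `^ (1 - t).
have Y0 : 0 <= Y by rewrite !mulr_ge0 ?powR_ge0// ltW.
have TY : k * (2 * rho) `^ t * I `^ (1 - t) <=
    (1 - t) * k * m `^ (- t) * I + Y.
  rewrite {1}(_ : I = m * (I / m)); last by field; rewrite gt_eqF.
  rewrite (@powRM _ m) ?(ltW m0)// ?divr_ge0 ?(ltW m0)//.
  have := @powR_amgm _ t (I / m) (2 * rho) t01.
  rewrite divr_ge0 ?(ltW m0)// mulr_ge0 ?(ltW rho0)// => /(_ isT isT).
  move=> /(ler_wpM2l (mulr_ge0 k0 (powR_ge0 m (1 - t)))).
  rewrite -mpow /Y => h; apply: le_trans (le_trans h _); last first.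
    rewrite le_eqVlt; apply/orP; left; apply/eqP; ring.
  by rewrite le_eqVlt; apply/orP; left; apply/eqP; ring.
apply/lee_addgt0Pr => e e0.
(* lowering the peak from m to m (1 - r) costs at most Y r <= e *)
pose r := e / (Y + e).
have Ye0 : 0 < Y + e by rewrite ltr_wpDl.
have r0 : 0 < r by rewrite divr_gt0.
have r1 : r <= 1 by rewrite ler_pdivrMr// mul1r lerDr.
have [_ [x _ <-] Fx] : exists2 z, range F z & m - m * r < z.
  by apply: sup_adherent => //; rewrite mulr_gt0.
have mFx : m `^ (1 - t) * (1 - r) <= F x `^ (1 - t).
  apply: (@le_trans _ _ ((m * (1 - r)) `^ (1 - t))).
    rewrite powRM ?(ltW m0) ?subr_ge0// ler_wpM2l ?powR_ge0//.
    have [->|rn1] := eqVneq r 1; first by rewrite subrr powR_ge0.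
    have r1' : 0 < 1 - r by rewrite subr_gt0 lt_neqAle rn1.
    rewrite -{1}(powRr1 (ltW r1')) ger_powR ?r1' ?lerBlDr ?lerDl ?(ltW r0)//.
    by rewrite ltW.
  apply: ge0_ler_powR; rewrite ?nnegrE ?(ltW u0)//.
    by rewrite mulr_ge0 ?(ltW m0)// subr_ge0.
  by rewrite mulrBr mulr1 ltW.
have F0m z : 0 <= F z <= m by rewrite F0 Fm.
have := @cube_line_peak t rho k m x F H t01 rho0 k0 m0 mF F0m mH H0 FH.
rewrite FI => /(leeD2r e%:E); apply: le_trans.
rewrite -EFinM -!EFinD lee_fin (le_trans TY)// -addrA lerD2l.
apply: (@le_trans _ _ (Y * (1 - r) + e)).
  have -> : Y * (1 - r) + e = Y + (e - Y * r) by ring.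
  rewrite lerDl subr_ge0 /r mulrA ler_pdivrMr// mulrDr mulrC.
  by rewrite lerDl mulr_ge0// ltW.
rewrite lerD2r /Y -mulrA ler_wpM2l//.
by rewrite !mulr_ge0// ltW.
Qed.

End cube_line.

Section cube_rV.
Context (R : realType).
Notation mu := (@lebesgue_measure R).

Lemma ge0_integral_rVS (n : nat) (f : 'rV[R]_n.+1 -> \bar R) :
  measurable_fun setT f -> (forall x, 0 <= f x)%E ->
  (\int[lebesgue_rV R n.+1]_x f x =
   \int[lebesgue_rV R n]_v \int[mu]_x f (cons_rV (x, v)))%E.
Proof.
move=> mf f0.
have f0T : {in setT, forall x, 0 <= f x}%E by [].
have mcons : @measurable_fun _ _ (measurableTypeR R * 'rV[R]_n)%type
  'rV[R]_n.+1 setT (@cons_rV R n) by exact: measurable_cons_rV.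
have := @ge0_integral_pushforward _ _ _ _ _ _ mcons
  (mu \x lebesgue_rV R n)%E setT f measurableT mf f0T.
rewrite preimage_setT fubini_tonelli2.
- by move=> <-.
- exact: (measurableT_comp mf mcons).
- by move=> x; exact: f0.
Qed.

Lemma cons_rV_combination (n : nat) (s t : R) (x y : R) (v w : 'rV[R]_n) :
  cons_rV (s * x + t * y, s *: v + t *: w) =
  s *: cons_rV (x, v) + t *: cons_rV (y, w).
Proof.
by apply/rowP => j; rewrite !mxE; case: unliftP => [k|] _ /=; rewrite ?mxE.
Qed.

(** Induction on the dimension by Tonelli: the one-dimensional inequality, applied
    on the lines parallel to the first axis, says that the marginals of [F] and
    [H] satisfy the hypothesis again, with [k] multiplied by
    [(2 * rho) `^ t].  The bounded support keeps the marginals of [F] finite. *)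
Lemma cube_ineq (n : nat) (t rho k I : R) (F : 'rV[R]_n -> R)
    (H : 'rV[R]_n -> \bar R) :
  0 < t < 1 -> 0 < rho -> 0 <= k ->
  measurable_fun setT F -> (forall x, 0 <= F x) ->
  (exists C : R, forall x, F x <= C) ->
  (exists r : R, forall x : 'rV[R]_n, F x != 0 -> forall j, `|x ord0 j| <= r) ->
  (\int[lebesgue_rV R n]_x (F x)%:E = I%:E)%E ->
  measurable_fun setT H -> (forall x, 0 <= H x)%E ->
  (forall x y : 'rV[R]_n, (forall j, `|y ord0 j| <= rho) ->
    ((k * F x `^ (1 - t))%:E <= H ((1 - t) *: x + t *: y)%R)%E) ->
  ((k * (2 * rho) `^ t ^+ n * I `^ (1 - t))%:E <=
    \int[lebesgue_rV R n]_x H x)%E.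
Proof.
move=> t01 rho0; elim: n k F H => [|n IHn] k F H k0 mF F0 [C FC] [r Fr] FI mH H0 FH.
  move: FI; rewrite /= integral_dirac//; last exact/measurable_EFinP.
  rewrite diracT mul1e => -[<-].
  rewrite integral_dirac// diracT mul1e expr0 mulr1.
  have := FH 0 0; rewrite !scaler0 addr0; apply.
  by case.
have C0 : 0 <= C by exact: le_trans (F0 0) (FC 0).
pose r' : R := Num.max r 0.
have r'0 : 0 <= r' by rewrite le_max lexx orbT.
have mFc : measurable_fun setT (F \o @cons_rV R n).
  exact: measurableT_comp mF (@measurable_cons_rV R n).
have mHc : measurable_fun setT (H \o @cons_rV R n).
  exact: measurableT_comp mH (@measurable_cons_rV R n).
have mFcE : measurable_fun setT (EFin \o (F \o @cons_rV R n)) by exact/measurable_EFinP.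
pose G v := (\int[mu]_x (F (cons_rV (x, v)))%:E)%E.
have G0 v : (0 <= G v)%E by apply: integral_ge0 => x _; rewrite lee_fin.
have mFv v : measurable_fun setT (fun x => F (cons_rV (x, v))).
  exact: measurableT_comp mFc (pair2_measurable v).
have mFvE v : measurable_fun setT (EFin \o (fun x => F (cons_rV (x, v)))).
  exact/measurable_EFinP.
have GC v : (G v <= (C * (2 * r'))%:E)%E.
  have -> : (C * (2 * r'))%:E = (\int[mu]_(x in `[(- r')%R, r']) C%:E)%E.
    rewrite integral_cst//= lebesgue_measure_itv/= lte_fin.
    case: ltP => h; first by rewrite -EFinB -EFinM; congr (_%:E); ring.
    have -> : r' = 0 by lra.
    by rewrite !mulr0 mule0.
  rewrite integral_mkcond; apply: ge0_le_integral => //.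
  - by move=> x _; rewrite lee_fin.
  - exact: mFvE.
  - by apply/(measurable_restrictT _ _).1.
  move=> x _; rewrite patchE; case: ifPn => [_|]; first by rewrite lee_fin.
  rewrite notin_setE/= in_itv/= -ler_norml => xr; rewrite lee_fin.
  have [->//|/Fr/(_ ord0)] := eqVneq (F (cons_rV (x, v))) 0.
  rewrite mxE unlift_none/= => xr'; exfalso; apply: xr.
  by rewrite (le_trans xr')// le_max lexx.
have Gfin v : G v \is a fin_num.
  by rewrite ge0_fin_numE// (le_lt_trans (GC v))// ltry.
have Gfine v : ((fine (G v))%:E = G v)%E by rewrite fineK.
have mG : measurable_fun setT G.
  have cE x : (0 <= (EFin \o (F \o @cons_rV R n)) x)%E by rewrite /= lee_fin.
  exact: (@measurable_fun_fubini_tonelli_G _ _ (measurableTypeR R) _ R mu _ mFcE cE).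
rewrite ge0_integral_rVS// exprS mulrA.
apply: (IHn _ (fine \o G)) => //.
- by rewrite mulr_ge0// powR_ge0.
- exact: measurableT_comp.
- by move=> v; exact: fine_ge0.
- by exists (C * (2 * r')) => v; rewrite -lee_fin Gfine.
- exists r => v /= Gv j; rewrite leNgt; apply/negP => rv; move/eqP : Gv; apply.
  rewrite /G integral0_eq// => x _; apply/eqP; rewrite eqe.
  apply/negPn/negP => /Fr/(_ (lift ord0 j)); rewrite mxE liftK/=.
  by rewrite leNgt rv.
- rewrite -FI ge0_integral_rVS.
  + by apply: eq_integral => v _; rewrite /= Gfine.
  + exact/measurable_EFinP.
  + by move=> x; rewrite lee_fin.
- exact: (@measurable_fun_fubini_tonelli_G _ _ (measurableTypeR R) _ R mu _ mHc
    (fun x => H0 _)).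
- by move=> v; exact: integral_ge0.
- move=> v w vw /=.
  apply: (cube_line_ineq (F := fun x => F (cons_rV (x, v)))) => //.
  + by exists C => x.
  + exact: measurableT_comp mHc (pair2_measurable _).
  move=> x y yrho; rewrite cons_rV_combination; apply: FH => j.
  by rewrite mxE; case: unliftP => [i _|_] /=; [exact: vw|].
Qed.

End cube_rV.

(** * Euclidean norm and distance *)

Section euclidean_facts.
Context (R : realType) (n : nat).
Implicit Types (x y z : 'rV[R]_n) (A : set 'rV[R]_n).

Lemma dotvDr x y z : dotv x (y + z) = dotv x y + dotv x z.
Proof.
by rewrite /dotv -big_split/=; apply: eq_bigr => j _; rewrite mxE mulrDr.
Qed.

Lemma dotvZr (a : R) x y : dotv x (a *: y) = a * dotv x y.
Proof.
by rewrite /dotv mulr_sumr; apply: eq_bigr => j _; rewrite mxE mulrCA.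
Qed.

Lemma dotvC x y : dotv x y = dotv y x.
Proof. by apply: eq_bigr => j _; rewrite mulrC. Qed.

Lemma dotv_ge0 x : 0 <= dotv x x.
Proof. by apply: sumr_ge0 => j _; rewrite -expr2 sqr_ge0. Qed.

Lemma enorm_ge0 x : 0 <= enorm x. Proof. exact: sqrtr_ge0. Qed.

Lemma enorm_sqr x : enorm x ^+ 2 = dotv x x.
Proof. by rewrite sqr_sqrtr// dotv_ge0. Qed.

Lemma enormZ (a : R) x : enorm (a *: x) = `|a| * enorm x.
Proof.
rewrite /enorm dotvZr dotvC dotvZr mulrA -expr2 sqrtrM ?sqr_ge0//.
by rewrite sqrtr_sqr.
Qed.

Lemma enormN x : enorm (- x) = enorm x.
Proof. by rewrite -scaleN1r enormZ normrN1 mul1r. Qed.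

Lemma enormB x y : enorm (x - y) = enorm (y - x).
Proof. by rewrite -enormN opprB. Qed.

Lemma enorm0 : enorm (0 : 'rV[R]_n) = 0.
Proof. by rewrite -(scale0r 0) enormZ normr0 mul0r. Qed.

Lemma dotv_le x y : dotv x y <= enorm x * enorm y.
Proof.
have [y0|] := eqVneq (dotv y y) 0.
  have -> : dotv x y = 0.
    apply: big1 => j _; suff -> : y ord0 j = 0 by rewrite mulr0.
    apply/eqP; rewrite -sqrf_eq0 expr2; apply/eqP.
    by apply: (psumr_eq0P _ y0) => // k _; rewrite -expr2 sqr_ge0.
  by rewrite mulr_ge0// enorm_ge0.
move=> yn0; have y0 : 0 < dotv y y by rewrite lt_neqAle eq_sym yn0 dotv_ge0.
have := dotv_ge0 (dotv y y *: x + (- dotv x y) *: y).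
rewrite dotvDr !dotvZr !(dotvC (_ + _)) !dotvDr !dotvZr (dotvC y x) => h.
apply: le_trans (ler_norm _) _.
rewrite -sqrtr_sqr /enorm -sqrtrM ?dotv_ge0//; apply: ler_wsqrtr.
by rewrite -(ler_pM2l y0); nra.
Qed.

Lemma enormD x y : enorm (x + y) <= enorm x + enorm y.
Proof.
rewrite -(ger0_norm (addr_ge0 (enorm_ge0 x) (enorm_ge0 y))) -sqrtr_sqr.
apply: ler_wsqrtr; rewrite sqrrD !enorm_sqr.
rewrite dotvDr !(dotvC (_ + _)) !dotvDr (dotvC y x).
have := dotv_le x y; nra.
Qed.

Lemma enorm_triangle x y z : enorm (x - z) <= enorm (x - y) + enorm (y - z).
Proof. by rewrite -(subrKA y) enormD. Qed.

Lemma le_enorm x y : (forall j, `|x ord0 j| <= `|y ord0 j|) ->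
  enorm x <= enorm y.
Proof.
move=> xy; apply: ler_wsqrtr; apply: ler_sum => j _.
rewrite -!expr2 -(real_normK (num_real (x _ _))) -(real_normK (num_real (y _ _))).
by rewrite ler_sqr ?nnegrE.
Qed.

Lemma le_coord_enorm x j : `|x ord0 j| <= enorm x.
Proof.
rewrite -sqrtr_sqr; apply: ler_wsqrtr.
rewrite /dotv (bigD1 j)//= -expr2 lerDl.
by apply: sumr_ge0 => k _; rewrite -expr2 sqr_ge0.
Qed.

Lemma continuous_enormB y : continuous (fun x : 'rV[R]_n => enorm (x - y)).
Proof.
move=> x; rewrite /enorm; apply: continuous_comp; last exact: sqrt_continuous.
rewrite /dotv; apply: cvg_big; [exact: add_continuous|exact: nbhs_filter|move=> j _].
have cj : {for x, continuous (fun z : 'rV[R]_n => (z - y) ord0 j)}.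
  rewrite (_ : (fun z => _) = (fun z : 'rV[R]_n => z ord0 j - y ord0 j)).
    by apply: continuousB; [exact: coord_continuous|exact: cst_continuous].
  by apply/funext => z; rewrite !mxE.
exact: (continuousM cj cj).
Qed.

Lemma continuous_measurable_rV (f : 'rV[R]_n -> R) : continuous f ->
  measurable_fun setT f.
Proof.
move=> cf; apply: (measurability (@RGenOpens.G R)).
  exact: RGenOpens.measurableE.
move=> _ [_ [a [b ->]] <-]; rewrite setTI; apply: open_measurable_rV.
by apply: open_comp; [move=> x _; exact: cf|exact: interval_open].
Qed.

Lemma measurable_enormB y :
  measurable_fun setT (fun x : 'rV[R]_n => enorm (x - y)).
Proof. by apply: continuous_measurable_rV; exact: continuous_enormB. Qed.

Lemma measurable_enorm_ball y (r : R) :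
  measurable [set x : 'rV[R]_n | enorm (x - y) <= r].
Proof.
have := measurable_enormB y measurableT (@measurable_itv R `]-oo, r]).
by rewrite setTI (_ : _ @^-1` _ = [set x | enorm (x - y) <= r]).
Qed.

Lemma edist_set_le x y A : A y -> (edist_set x A <= (enorm (x - y))%:E)%E.
Proof. by move=> Ay; apply: ereal_inf_lbound; exists y. Qed.

Lemma measurable_edist_set A (h : R) :
  measurable [set x | (edist_set x A <= h%:E)%E].
Proof.
have -> : [set x | (edist_set x A <= h%:E)%E] =
    \bigcap_k \bigcup_(y in A) [set x | enorm (x - y) < h + k.+1%:R^-1].
  apply/seteqP; split => [x /= xA k _|x /= xA].
    have : (edist_set x A < (h + k.+1%:R^-1)%:E)%E.
      by rewrite (le_lt_trans xA)// lte_fin ltrDl invr_gt0.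
    move=> /ereal_inf_lt[_ [y Ay <-]]; rewrite lte_fin => xy.
    by exists y.
  apply/lee_addgt0Pr => e e0.
  have [k ke] : exists k, k.+1%:R^-1 < e.
    exists (Num.truncn e^-1).
    by rewrite invf_plt ?posrE//; exact: truncnS_gt.
  have [y Ay /= xy] := xA k I.
  apply: (le_trans (edist_set_le x Ay)); rewrite -EFinD lee_fin ltW//.
  by rewrite (lt_le_trans xy)// lerD2l ltW.
apply: bigcapT_measurable => k; apply: open_measurable_rV.
apply: bigcup_open => y _.
rewrite (_ : mkset _ = (fun x => enorm (x - y)) @^-1` [set z | z < h + k.+1%:R^-1]).
  by apply: open_comp; [move=> x _; exact: continuous_enormB|exact: open_lt].
by [].
Qed.

End euclidean_facts.

(** * Cost and potential *)

Section cost_potential.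
Context (R : realType) (n : nat).
Implicit Types (x y : 'rV[R]_n) (c V : 'rV[R]_n -> R).

Lemma cost_star_shaped c x (s : R) :
  (forall x, c x = 0) \/
    [/\ cost_function c, strictly_convex c & superlinear c] ->
  0 <= s <= 1 -> c (s *: x) <= s * c x.
Proof.
move=> [c0|[[_ c00] cconv _]] /andP[s0 s1]; first by rewrite !c0 mulr0.
have [->|sn0] := eqVneq s 0; first by rewrite scale0r c00 mul0r.
have [->|sn1] := eqVneq s 1; first by rewrite scale1r mul1r.
have [->|xn0] := eqVneq x 0; first by rewrite scaler0 c00 mulr0.
have s01 : 0 < s < 1 by rewrite !lt_neqAle eq_sym sn0 s0 sn1 s1.
by have := cconv x 0 s xn0 s01; rewrite scaler0 addr0 c00 mulr0 addr0 => /ltW.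
Qed.

Lemma cost_nonneg c x :
  (forall x, c x = 0) \/
    [/\ cost_function c, strictly_convex c & superlinear c] ->
  0 <= c x.
Proof. by case=> [->//|[[c0 _] _ _]]. Qed.

Lemma cost_monotone c (ctilde : R -> R) x y :
  (forall x, c x = ctilde (enorm x)) ->
  (forall x, c x = 0) \/
    [/\ cost_function c, strictly_convex c & superlinear c] ->
  enorm x <= enorm y -> c x <= c y.
Proof.
move=> crad ccost xy.
have [y0|yn0] := eqVneq (enorm y) 0.
  rewrite !crad (_ : enorm x = enorm y)//.
  by apply/eqP; rewrite eq_le xy y0 enorm_ge0.
have y0 : 0 < enorm y by rewrite lt_neqAle eq_sym yn0 enorm_ge0.
have s01 : 0 <= enorm x / enorm y <= 1.
  by rewrite divr_ge0 ?enorm_ge0//= ler_pdivrMr// mul1r.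
have -> : c x = c ((enorm x / enorm y) *: y).
  rewrite !crad enormZ ger0_norm ?divr_ge0 ?enorm_ge0//.
  by rewrite -mulrA mulVf// mulr1.
apply: le_trans (cost_star_shaped y ccost s01) _.
by have /andP[_ ?] := s01; rewrite ler_piMl// cost_nonneg.
Qed.

(** Both defects are taken at the intermediate point [z].  Since
    [(1 - t) (x - z) + t (y - z) = 0], the gradient disappears from the convex
    combination. *)
Lemma potential_semiconvex V c (ctilde : R -> R) (t : R) x y :
  (forall x, c x = ctilde (enorm x)) ->
  (forall x, c x = 0) \/
    [/\ cost_function c, strictly_convex c & superlinear c] ->
  (forall x y, convexity_defect V x y <= c (x - y)) -> 0 <= t <= 1 ->
  V ((1 - t) *: x + t *: y) <=
    (1 - t) * V x + t * V y + 2 * t * (1 - t) * c (x - y).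
Proof.
move=> crad ccost Vdef /andP[t0 t1].
set z := _ + _.
have u0 : 0 <= 1 - t by rewrite subr_ge0.
have u1 : 1 - t <= 1 by rewrite lerBlDr lerDl.
have xz : x - z = t *: (x - y).
  by apply/rowP => j; rewrite !mxE; ring.
have yz : y - z = (1 - t) *: (y - x).
  by apply/rowP => j; rewrite !mxE; ring.
have csym w : c (- w) = c w by rewrite !crad enormN.
have c1 : c (z - x) <= t * c (x - y).
  rewrite -csym opprB xz; apply: cost_star_shaped => //.
  by rewrite t0.
have c2 : c (z - y) <= (1 - t) * c (x - y).
  rewrite -csym opprB yz -(csym (x - y)) opprB; apply: cost_star_shaped => //.
  by rewrite u0.
have := Vdef z x; have := Vdef z y; rewrite /convexity_defect.
rewrite xz yz !dotvZr (_ : dotv (gradient V z) (y - x) =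
  - dotv (gradient V z) (x - y)); last first.
  by rewrite -mulN1r -dotvZr scaleN1r opprB.
set g := dotv _ _ => d2 d1.
have e1 : (1 - t) * (V z - V x + t * g) <= (1 - t) * (t * c (x - y)).
  by rewrite ler_wpM2l//; apply: le_trans c1; apply: le_trans d1; lra.
have e2 : t * (V z - V y - (1 - t) * g) <= t * ((1 - t) * c (x - y)).
  by rewrite ler_wpM2l//; apply: le_trans c2; apply: le_trans d2; lra.
by have h := lerD e1 e2; clear - h; lra.
Qed.

End cost_potential.

(** * Measures with a density *)

(** By uniqueness, [g] is almost everywhere the Radon-Nikodym derivative. *)
Lemma ge0_integral_density d (T : measurableType d) (R : realType)
    (nu : {finite_measure set T -> \bar R})
    (la : {sigma_finite_measure set T -> \bar R}) (f g : T -> \bar R) :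
  measurable_fun setT g -> (forall x, 0 <= g x)%E ->
  (forall A, measurable A -> nu A = \int[la]_(x in A) g x)%E ->
  measurable_fun setT f -> (forall x, 0 <= f x)%E ->
  (\int[nu]_x f x = \int[la]_x (f x * g x))%E.
Proof.
move=> mg g0 nug mf f0.
have nula : nu `<< la.
  apply/null_content_dominatesP => A mA A0.
  by rewrite nug// null_set_integral//; exact: measurable_funTS.
rewrite -(Radon_Nikodym_SigmaFinite.change_of_variables nula f0 measurableT mf).
pose h := Radon_Nikodym_SigmaFinite.f nu la.
have ih : la.-integrable setT h := Radon_Nikodym_SigmaFinite.f_integrable nula.
have h0 : (forall x, 0 <= h x)%E := Radon_Nikodym_SigmaFinite.f_ge0 nula.
have mh := measurable_int _ ih.
have hg : ae_eq la setT h g.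
  apply: integral_ae_eq => // A _ mA.
  by rewrite -nug// (Radon_Nikodym_SigmaFinite.f_integral nula).
apply: ge0_ae_eq_integral => //.
- exact: emeasurable_funM.
- exact: emeasurable_funM.
- by move=> x _; exact: mule_ge0.
- by move=> x _; exact: mule_ge0.
- exact: ae_eqe_mul2l.
Qed.

(** * Domination of the cost by an integrable weight *)

Section weight.
Context (R : realType) (d : nat).
Variables (ctilde : R -> R) (c V : 'rV[R]_d -> R) (mu : probability 'rV[R]_d R).
Hypothesis c_radial : forall x, c x = ctilde (enorm x).
Hypothesis c_cost : (forall x, c x = 0) \/
  [/\ cost_function c, strictly_convex c & superlinear c].
Hypothesis V_cont : continuous V.
Hypothesis mu_density : forall A : set 'rV[R]_d, measurable A ->
  mu A = (\int[lebesgue_rV R d]_(x in A) (expR (- V x))%:E)%E.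

Lemma measurable_gibbs : measurable_fun setT (fun x => expR (- V x)).
Proof.
apply: measurableT_comp => //; apply: measurableT_comp => //.
exact: continuous_measurable_rV.
Qed.

Lemma measurable_box (I : 'I_d -> set R) : (forall j, measurable (I j)) ->
  measurable [set v : 'rV[R]_d | forall j, I j (v ord0 j)].
Proof.
move=> mI; rewrite (_ : mkset _ = \bigcap_(j in [set: 'I_d])
    ((fun v : 'rV[R]_d => v ord0 j) @^-1` I j)); last first.
  by apply/seteqP; split => [x Bx j _|x Bx j]; [exact: Bx|exact: (Bx j)].
apply: fin_bigcap_measurable => // j _.
by rewrite -[X in measurable X]setTI; exact: measurable_coord_rV.
Qed.

Lemma lebesgue_rV0_of_gibbs0 (Q : set 'rV[R]_d) : measurable Q ->
  mu Q = 0%E -> lebesgue_rV R d Q = 0%E.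
Proof.
move=> mQ; rewrite mu_density// => Q0.
have mg : measurable_fun Q (fun x => (expR (- V x))%:E).
  by apply: measurable_funTS; apply/measurable_EFinP; exact: measurable_gibbs.
have [h _] := @ae_eq_integral_abs _ _ _ (lebesgue_rV R d) _ mQ _ mg.
have [|N [mN N0 QN]] := h _.
  rewrite -{}Q0; apply: eq_integral => x _.
  by rewrite gee0_abs// lee_fin expR_ge0.
apply/eqP; rewrite eq_le measure_ge0 andbT -N0 le_measure ?inE//.
move=> x Qx; apply: QN => /(_ Qx) /eqP.
by rewrite eqe gt_eqF// expR_gt0.
Qed.

(** Choose one point [y s] in each of the [2 ^ d] regions where all coordinates
    have prescribed signs [s] and exceed [rho] in modulus.  For any [x], the point
    whose signs are opposite to those of [x] is farther from [x], coordinate by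
    coordinate, than every point of the cube; hence the sum over [s] dominates.
    By Fubini almost every point makes [exp (p c (y - x))] integrable in [x], and
    the regions have positive measure. *)
Lemma cost_weight (rho p : R) : 0 < rho -> 0 < p ->
  (mu \x mu)%E.-integrable [set: 'rV[R]_d * 'rV[R]_d]
    (fun z => (expR (p * c (z.1 - z.2)))%:E) ->
  exists (W : 'rV[R]_d -> R) (C : R),
    [/\ measurable_fun setT W, forall x, 1 <= W x,
      (\int[lebesgue_rV R d]_x (W x * expR (- V x))%:E = C%:E)%E &
      forall x y : 'rV[R]_d, (forall j, `|y ord0 j| <= rho) ->
        expR (p * c (x - y)) <= W x].
Proof.
move=> rho0 p0 cint.
pose I (b : bool) : set R :=
  if b then `]rho, (rho + 1)[%classic else `](- rho - 1), (- rho)[%classic.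
have mI b : measurable (I b) by case: b => /=.
have lI b : lebesgue_measure (I b) = 1%E.
  case: b; rewrite /I lebesgue_measure_itv/= lte_fin.
    by rewrite ltrDl ltr01 -EFinB; congr (_%:E); ring.
  by rewrite ltrBlDr ltrDl ltr01 -EFinB; congr (_%:E); ring.
pose Q (s : {ffun 'I_d -> bool}) : set 'rV[R]_d :=
  [set v | forall j, I (s j) (v ord0 j)].
have mQ s : measurable (Q s) by exact: (measurable_box (fun j => mI (s j))).
have Qn0 s : mu (Q s) <> 0%E.
  move=> /(lebesgue_rV0_of_gibbs0 (mQ s)) /eqP.
  rewrite (lebesgue_rV_prod (fun j => mI (s j))).
  by rewrite big1 ?onee_eq0// => j _; exact: lI.
have /choice[y yQ] : forall s, exists y, Q s y /\
    mu.-integrable setT (fun x => (expR (p * c (y - x)))%:E).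
  move=> s; have [N [mN N0 goodN]] := ae_integrable1 cint.
  apply: contrapT => /forallNP Qbad; apply: (Qn0 s); apply/eqP.
  rewrite eq_le measure_ge0 andbT -N0 le_measure ?inE// => y Qy.
  by apply: goodN => /= yint; apply: (Qbad y).
pose W (x : 'rV[R]_d) := \sum_s expR (p * c (y s - x)).
have We s x : expR (p * c (y s - x)) <= W x.
  rewrite /W (bigD1 s)//= lerDl; apply: sumr_ge0 => i _.
  exact: expR_ge0.
have mWs s : measurable_fun setT (fun x : 'rV[R]_d => expR (p * c (y s - x))).
  by have [_ /measurable_int/measurable_EFinP] := yQ s.
have mW : measurable_fun setT W by apply: measurable_sum => s; exact: mWs.
have W1 x : 1 <= W x.
  apply: le_trans (We [ffun=> true] x).
  by rewrite -expR0 ler_expR mulr_ge0 ?(ltW p0)// (cost_nonneg _ c_cost).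
have iW : mu.-integrable setT (fun x => (W x)%:E).
  rewrite (_ : (fun x => _) =
    (fun x : 'rV[R]_d => \sum_s (expR (p * c (y s - x)))%:E)%E); last first.
    by apply/funext => x; rewrite sumEFin.
  by apply: integrable_sum => // s _; have [] := yQ s.
exists W, (fine (\int[mu]_x (W x)%:E)%E); split => //.
- rewrite fineK; last exact: integrable_fin_num.
  under eq_integral do rewrite EFinM.
  rewrite (ge0_integral_density (g := fun x => (expR (- V x))%:E) (la := lebesgue_rV R d))//.
  + by apply/measurable_EFinP; exact: measurable_gibbs.
  + exact/measurable_EFinP.
  + by move=> x; rewrite lee_fin (le_trans _ (W1 x)).
move=> x z zrho.
(* s j = true selects a positive coordinate, the sign opposite to that of x *)
pose s := [ffun j => x ord0 j < 0].
apply: le_trans (We s x); rewrite ler_expR ler_wpM2l ?(ltW p0)//.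
apply: (cost_monotone c_radial c_cost).
rewrite [leRHS]enormB; apply: le_enorm => j; rewrite !mxE.
have := zrho j; rewrite ler_norml => /andP[z1 z2].
have [/(_ j)] := yQ s; rewrite /I {1}/s ffunE; move: (y s ord0 j) => w + _.
case: ltP => xj; rewrite /= in_itv/= => /andP[y1 y2].
  rewrite (ler0_norm (x := x ord0 j - w)); last lra.
  by rewrite ler_norml; apply/andP; split; lra.
rewrite (ger0_norm (x := x ord0 j - w)); last lra.
by rewrite ler_norml; apply/andP; split; lra.
Qed.

End weight.

(** * Expansion of a bounded set towards a cube *)

Lemma continuous_box_bounded (R : realType) (d : nat) (f : 'rV[R]_d -> R) (r : R) :
  continuous f -> exists C : R, forall x : 'rV[R]_d,
    (forall j, `|x ord0 j| <= r) -> f x <= C.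
Proof.
move=> cf; pose B : set 'rV[R]_d := [set v | forall j, `[(- r), r]%classic (v ord0 j)].
have cB : compact B.
  by apply: (@rV_compact _ _ (fun=> `[(- r), r]%classic)) => j; exact: segment_compact.
have [M [_ /(_ (M + 1))]] :=
  compact_bounded (continuous_compact (continuous_subspaceT cf) cB).
rewrite ltrDl ltr01 => /(_ isT) MB; exists (M + 1) => x xr.
apply: le_trans (ler_norm _) _; apply: MB; exists x => //.
by move=> j; rewrite /= in_itv/= -ler_norml.
Qed.

Lemma integral_indicM (R : realType) (d : nat)
    (m : {measure set 'rV[R]_d -> \bar R}) (A : set 'rV[R]_d)
    (g : 'rV[R]_d -> R) :
  (\int[m]_x (\1_A x * g x)%:E = \int[m]_(x in A) (g x)%:E)%E.
Proof.
rewrite [RHS]integral_mkcond; apply: eq_integral => x _.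
rewrite patchE indicE; case: ifP => _; first by rewrite mul1r.
by rewrite mul0r.
Qed.

Section expansion.
Context (R : realType) (d : nat).
Variables (ctilde : R -> R) (c V : 'rV[R]_d -> R) (mu : probability 'rV[R]_d R).
Hypothesis c_radial : forall x, c x = ctilde (enorm x).
Hypothesis c_cost : (forall x, c x = 0) \/
  [/\ cost_function c, strictly_convex c & superlinear c].
Hypothesis V_cont : continuous V.
Hypothesis mu_density : forall A : set 'rV[R]_d, measurable A ->
  mu A = (\int[lebesgue_rV R d]_(x in A) (expR (- V x))%:E)%E.
Hypothesis V_defect : forall x y, convexity_defect V x y <= c (x - y).

(** [cube_ineq] applied to [F = 1_E exp (- V) W^(- 2 t / p)] and
    [H = 1_S exp (- V)].  The lower bound on the integral of [F] is the entropy
    inequality: linearise [W^(- q)] at the level [W = C / a] and bound the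
    logarithm that appears by the integrable [W] itself. *)
Lemma cube_expansion (p v C r t a : R) (W : 'rV[R]_d -> R) (E S : set 'rV[R]_d) :
  0 < p -> (forall y : 'rV[R]_d, (forall j, `|y ord0 j| <= 1) -> V y <= v) ->
  measurable_fun setT W -> (forall x, 1 <= W x) ->
  (\int[lebesgue_rV R d]_x (W x * expR (- V x))%:E = C%:E)%E ->
  (forall x y : 'rV[R]_d, (forall j, `|y ord0 j| <= 1) ->
    expR (p * c (x - y)) <= W x) ->
  0 < t < 1 -> measurable E -> measurable S ->
  (forall x j, E x -> `|x ord0 j| <= r) ->
  (forall x y : 'rV[R]_d, E x -> (forall j, `|y ord0 j| <= 1) ->
    S ((1 - t) *: x + t *: y)) ->
  0 < a -> mu E = a%:E ->
  ((a * (1 + t * ((1 - 2 / p) * ln (1 / a)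
                  - (2 / p * ln C + v - d%:R * ln 2))))%:E <= mu S)%E.
Proof.
move=> p0 Vv mW W1 WC cW t01 mE mS Er ES a0 muE; have /andP[t0 t1] := t01.
have u0 : 0 < 1 - t by rewrite subr_gt0.
have V_meas := continuous_measurable_rV V_cont.
pose q := 2 * t / p.
have q0 : 0 < q by rewrite divr_gt0// mulr_gt0.
have W0 x : 0 < W x by exact: lt_le_trans (W1 x).
have mg : measurable_fun setT (fun x => expR (- V x)) by exact: measurable_gibbs.
have gibbs_cont : continuous (fun x => expR (- V x)).
  move=> x; apply: continuous_comp; last exact: continuous_expR.
  by apply: continuousN; exact: V_cont.
have mgE : measurable_fun setT (fun x => (expR (- V x))%:E).
  exact/measurable_EFinP.
have mWg : measurable_fun setT (fun x => (W x * expR (- V x))%:E).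
  by apply/measurable_EFinP; exact: measurable_funM.
have mu1 : (\int[lebesgue_rV R d]_x (expR (- V x))%:E = 1)%E.
  by rewrite -mu_density// probability_setT.
have C1 : 1 <= C.
  rewrite -lee_fin -WC -mu1; apply: ge0_le_integral => // x _.
  by rewrite lee_fin ler_peMl// expR_ge0.
have C0 : 0 < C := lt_le_trans ltr01 C1.
have a1 : a <= 1 by rewrite -lee_fin -muE probability_le1.
pose s := ln C - ln a.
have s0 : 0 <= s.
  by rewrite subr_ge0 (le_trans (ln_le0 a1))// ln_ge0.
pose f x := expR (- V x - q * ln (W x)).
pose F x := \1_E x * f x.
have mf : measurable_fun setT f.
  apply: measurableT_comp => //; apply: measurable_funB.
    exact: measurableT_comp.
  by apply: measurable_funM => //; exact: measurableT_comp.
have mF : measurable_fun setT F by apply: measurable_funM => //; exact: measurable_indic.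
have f0 x : 0 <= f x := expR_ge0 _.
have F0 x : 0 <= F x by rewrite mulr_ge0// indicE ler0n.
have fg x : f x <= expR (- V x).
  by rewrite ler_expR gerBl mulr_ge0 ?ln_ge0// ltW.
have Ffin : (\int[lebesgue_rV R d]_x (F x)%:E)%E \is a fin_num.
  rewrite ge0_fin_numE; last by apply: integral_ge0 => x _; rewrite lee_fin.
  rewrite integral_indicM (@le_lt_trans _ _ (mu E))//; last by rewrite muE ltry.
  rewrite mu_density//; apply: ge0_le_integral => //.
  - by move=> x _; rewrite lee_fin.
  - by apply: measurable_funTS; exact/measurable_EFinP.
  - exact: measurable_funTS.
  - by move=> x _; rewrite lee_fin.
pose I := fine (\int[lebesgue_rV R d]_x (F x)%:E)%E.
have FI : (\int[lebesgue_rV R d]_x (F x)%:E = I%:E)%E by rewrite fineK.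
pose k0 := expR (- (q * s)).
have k00 : 0 < k0 := expR_gt0 _.
have I_ge : k0 * a <= I.
  have k1 : 0 <= k0 * (1 + q) by rewrite mulr_ge0 ?addr_ge0// ltW.
  have k2 : 0 <= k0 * q * (a / C) by rewrite !mulr_ge0 ?invr_ge0// ltW.
  (* W^(-q) >= k0 (1 + q - q (a / C) W), where k0 is the value of W^(-q) at C / a *)
  have pw x : ((k0 * (1 + q))%:E * (\1_E x * expR (- V x))%:E <=
      (F x)%:E + (k0 * q * (a / C))%:E * (W x * expR (- V x))%:E)%E.
    rewrite -!EFinM -EFinD lee_fin /F indicE; case: (x \in E); last first.
      by rewrite !mul0r mulr0 add0r mulr_ge0// mulr_ge0 ?expR_ge0// ltW.
    rewrite !mul1r; set g := expR (- V x).
    pose w := ln (W x) - s.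
    have -> : f x = k0 * g * expR (- (q * w)).
      by rewrite /f /k0 /g -!expRD; congr expR; rewrite /w; ring.
    have Ww : W x * (a / C) = expR w.
      by rewrite /w /s opprB addrA expRB expRD !lnK ?posrE// mulrA.
    have -> : k0 * q * (a / C) * (W x * g) = k0 * g * (q * expR w).
      by rewrite -Ww; ring.
    rewrite -mulrDr -mulrA [leLHS](_ : _ = k0 * g * (1 + q)); last by ring.
    rewrite ler_wpM2l ?mulr_ge0 ?expR_ge0//.
    have e1 := expR_ge1Dx (- (q * w)).
    have e2 : q * (1 + w) <= q * expR w by rewrite ler_wpM2l ?expR_ge1Dx// ltW.
    by apply: le_trans (lerD e1 e2); lra.
  have m1 : measurable_fun setT (fun x => (\1_E x * expR (- V x))%:E).
    by apply/measurable_EFinP; apply: measurable_funM => //; exact: measurable_indic.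
  have : (\int[lebesgue_rV R d]_x ((k0 * (1 + q))%:E * (\1_E x * expR (- V x))%:E) <=
      \int[lebesgue_rV R d]_x ((F x)%:E + (k0 * q * (a / C))%:E * (W x * expR (- V x))%:E))%E.
    apply: ge0_le_integral => //.
    - by move=> x _; rewrite -EFinM lee_fin mulr_ge0// mulr_ge0 ?expR_ge0.
    - exact: measurable_funeM.
    - apply: emeasurable_funD; first exact/measurable_EFinP.
      exact: measurable_funeM.
  rewrite ge0_integralZl ?lee_fin//.
  rewrite ge0_integralD//=; last first.
  - exact: measurable_funeM.
  - by move=> x _; rewrite -EFinM lee_fin mulr_ge0// mulr_ge0 ?expR_ge0// ltW.
  - exact/measurable_EFinP.
  - by move=> x _; rewrite lee_fin.
  rewrite ge0_integralZl ?lee_fin//; last first.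
    by move=> x _; rewrite lee_fin mulr_ge0 ?expR_ge0// ltW.
  rewrite WC FI integral_indicM -mu_density// muE -!EFinM -EFinD lee_fin.
  rewrite (_ : k0 * q * (a / C) * C = k0 * q * a); last by field; rewrite gt_eqF.
  by move=> h; lra.
apply: (@le_trans _ _
    (expR (- (t * v)) * (2 * 1) `^ t ^+ d * I `^ (1 - t))%:E); last first.
  rewrite mu_density// -integral_indicM.
  apply: (@cube_ineq R d t 1 _ I F) => //; rewrite ?expR_ge0//.
  - have [M VM] := continuous_box_bounded r gibbs_cont; exists (Num.max M 0) => x.
    rewrite /F indicE; case: (boolP (x \in E)) => [|_]; last first.
      by rewrite mul0r le_max lexx orbT.
    rewrite inE mul1r => Ex; apply: le_trans (fg x) _.
    by rewrite le_max VM// => j; exact: Er.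
  - exists r => x; rewrite /F indicE; case: (boolP (x \in E)) => [|_].
      by rewrite inE => Ex _ j; exact: Er.
    by rewrite mul0r eqxx.
  - by apply/measurable_EFinP; apply: measurable_funM => //; exact: measurable_indic.
  - move=> x y yB; rewrite lee_fin /F [X in X * f x]indicE.
    case: (boolP (x \in E)) => [|_]; last first.
      rewrite mul0r powR0 ?gt_eqF// mulr0 mulr_ge0 ?expR_ge0// indicE ler0n.
    rewrite inE => Ex; rewrite mul1r indicE mem_set ?mul1r; last exact: ES.
    rewrite /powR gt_eqF ?expR_gt0// expRK -expRD ler_expR.
    have := potential_semiconvex x y c_radial c_cost V_defect (_ : 0 <= t <= 1).
    rewrite (ltW t0) (ltW t1) => /(_ isT).
    have cW' : p * c (x - y) <= ln (W x).
      by rewrite -ler_expR lnK ?posrE//; exact: cW.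
    have cq : 2 * t * (1 - t) * c (x - y) <= (1 - t) * (q * ln (W x)).
      rewrite (_ : 2 * t * (1 - t) * c (x - y) = (1 - t) * (q * (p * c (x - y)))).
        by rewrite !ler_wpM2l// ltW.
      by rewrite /q; field; rewrite gt_eqF.
    have tv : t * V y <= t * v by rewrite ler_wpM2l ?Vv// ltW.
    by lra.
have la : ln (1 / a) = - ln a by rewrite div1r lnV.
have Ipow : expR ((1 - t) * (- (q * s) + ln a)) <= I `^ (1 - t).
  have -> : expR ((1 - t) * (- (q * s) + ln a)) = (k0 * a) `^ (1 - t).
    by rewrite /powR gt_eqF ?mulr_gt0// lnM// /k0 expRK.
  apply: ge0_ler_powR; rewrite ?nnegrE ?(ltW u0) ?mulr_ge0 ?(ltW a0) ?(ltW k00)//.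
  by rewrite (le_trans _ I_ge)// mulr_ge0// ltW.
rewrite lee_fin mulr1 -[X in X * (1 + _)](lnK a0).
have -> : 2 `^ t ^+ d = expR (d%:R * (t * ln 2)) :> R.
  by rewrite expRM_natl /powR pnatr_eq0.
rewrite -expRD.
apply: (@le_trans _ _ (expR (- (t * v) + d%:R * (t * ln 2)) *
   expR ((1 - t) * (- (q * s) + ln a)))); last by rewrite ler_wpM2l ?expR_ge0.
rewrite -expRD.
apply: (@le_trans _ _ (expR (ln a) * expR (t * ((1 - 2 / p) * ln (1 / a)
                  - (2 / p * ln C + v - d%:R * ln 2))))).
  by rewrite ler_wpM2l ?expR_ge0// expR_ge1Dx.
rewrite -expRD ler_expR la -subr_ge0.
rewrite [leRHS](_ : _ = t * q * s); first by exact: mulr_ge0 (mulr_ge0 (ltW t0) (ltW q0)) s0.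
by rewrite /q /s; field; rewrite gt_eqF.
Qed.

End expansion.

(** * Gain of measure in a neighbourhood of a small set *)

Lemma pigeonhole_increment (R : realFieldType) (g : nat -> R) (m : nat) (b : R) :
  (0 < m)%N -> g m - g 0%N <= b ->
  exists2 k, (k < m)%N & g k.+1 - g k <= b / m%:R.
Proof.
move=> m0 gb; apply: contrapT => nex.
have gk k : (k <= m)%N -> k%:R * (b / m%:R) <= g k - g 0%N.
  elim: k => [_|k IHk km]; first by rewrite mul0r subrr.
  rewrite -natr1 mulrDl mul1r.
  have : b / m%:R < g k.+1 - g k by rewrite ltNge; apply/negP => ?; apply: nex; exists k.
  have := IHk (ltnW km); lra.
have : b / m%:R < g m - g m.-1.
  rewrite ltNge; apply/negP => h; apply: nex; exists m.-1; rewrite ?prednK//.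
have := gk m.-1 (leq_pred m).
have mR : m%:R = m.-1%:R + 1 :> R by rewrite natr1 prednK.
have : m%:R * (b / m%:R) = b by rewrite mulrC divfK// pnatr_eq0 -lt0n.
rewrite {1}mR mulrDl mul1r; lra.
Qed.

Section gain.
Context (R : realType) (d : nat).
Variables (ctilde : R -> R) (c V : 'rV[R]_d -> R) (mu : probability 'rV[R]_d R).
Hypothesis c_radial : forall x, c x = ctilde (enorm x).
Hypothesis c_cost : (forall x, c x = 0) \/
  [/\ cost_function c, strictly_convex c & superlinear c].
Hypothesis V_cont : continuous V.
Hypothesis mu_density : forall A : set 'rV[R]_d, measurable A ->
  mu A = (\int[lebesgue_rV R d]_(x in A) (expR (- V x))%:E)%E.
Hypothesis V_defect : forall x y, convexity_defect V x y <= c (x - y).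

(** [N] stands for any set containing the [h]-neighbourhood of [E] outside [E].
    With [t = h / (3 r)], the set swept by [E] cut at radius [s] stays in [N]
    together with [E] cut at radius [s + h]; the radius [s] is chosen
    between [r] and [2 r] so that the two cuts of [E] differ little. *)
Lemma neighbourhood_gain (p v C L r a h : R) (x0 : 'rV[R]_d)
    (W : 'rV[R]_d -> R) (E N : set 'rV[R]_d) :
  3 <= p -> (forall y : 'rV[R]_d, (forall j, `|y ord0 j| <= 1) -> V y <= v) ->
  measurable_fun setT W -> (forall x, 1 <= W x) ->
  (\int[lebesgue_rV R d]_x (W x * expR (- V x))%:E = C%:E)%E ->
  (forall x y : 'rV[R]_d, (forall j, `|y ord0 j| <= 1) ->
    expR (p * c (x - y)) <= W x) ->
  (forall y : 'rV[R]_d, (forall j, `|y ord0 j| <= 1) -> enorm (y - x0) <= L) ->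
  0 < r -> L <= r -> 0 < a -> 288 <= ln (1 / a) ->
  6 * (2 / p * ln C + v - d%:R * ln 2) <= ln (1 / a) ->
  (mu [set x | (r < enorm (x - x0))%R] <= (a / 4)%:E)%E ->
  measurable E -> measurable N ->
  ((a / 2)%:E <= mu E)%E -> (mu E <= a%:E)%E ->
  0 < h -> h <= r / 2 ->
  (forall x z, E x -> ~ E z -> enorm (z - x) <= h -> N z) ->
  ((h * (a * ln (1 / a) / (144 * r)))%:E <= mu N)%E.
Proof.
move=> p3 Vv mW W1 WC cW yL r0 Lr a0 La288 LaQ tail mE mN Ea aE h0 hr EN.
have p0 : 0 < p by lra.
pose B (s : R) := [set x : 'rV[R]_d | enorm (x - x0) <= s].
have mB s : measurable (B s) by exact: measurable_enorm_ball.
have mEB s : measurable (E `&` B s) by exact: measurableI.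
have finm (A : set 'rV[R]_d) : measurable A -> mu A \is a fin_num.
  by move=> mA; exact: fin_num_measure.
pose g s := fine (mu (E `&` B s)).
have gE s : mu (E `&` B s) = (g s)%:E by rewrite /g fineK// finm.
have ga s : g s <= a.
  rewrite -lee_fin -gE; apply: le_trans aE; apply: le_measure; rewrite ?inE//.
have g0 s : 0 <= g s by rewrite -lee_fin -gE.
pose m := Num.truncn (r / h).
have rh : 2 <= r / h by rewrite ler_pdivlMr//; lra.
have /andP[mr rm] : m%:R <= r / h < m.+1%:R by apply: truncn_itv; lra.
have m2 : r / h / 2 <= m%:R by move: rm; rewrite -natr1; lra.
have m0 : 0 < m%:R :> R by lra.
have [||k km gk] := @pigeonhole_increment R (fun k => g (r + k%:R * h)) m a.
- by rewrite -(ltr0n R).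
- by rewrite /=; have := ga (r + m%:R * h); have := g0 (r + 0%:R * h); lra.
pose s := r + k%:R * h.
have rs : r <= s by rewrite lerDl mulr_ge0// ltW.
have s2r : s <= 2 * r.
  have : k%:R * h <= m%:R * h by rewrite ler_pM2r// ler_nat ltnW.
  move: mr; rewrite ler_pdivlMr// /s; lra.
have sS : r + k.+1%:R * h = s + h by rewrite /s -natr1; ring.
move: gk; rewrite /= sS -/s => gk.
have am : a / m%:R <= 2 * a * h / r.
  rewrite (_ : 2 * a * h / r = a / (r / h / 2)); last first.
    by field; rewrite !gt_eqF.
  by rewrite ler_pM2l// lef_pV2 ?posrE//; lra.
have gs : a / 4 <= g s.
  have : (mu E <= mu (E `&` B s) + mu [set x | (r < enorm (x - x0))%R])%E.
    have mB' : measurable [set x | (r < enorm (x - x0))%R].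
      rewrite (_ : mkset _ = ~` B r); first exact: measurableC.
      by apply/seteqP; split => x /=; rewrite ltNge; [move/negP|move=> /negP].
    apply: le_trans (measureU2 _ _ _) => //.
    apply: le_measure; rewrite ?inE//; first exact: measurableU.
    move=> x Ex; have [xs|sx] := leP (enorm (x - x0)) s; first by left.
    by right; rewrite /= (le_lt_trans rs).
  move=> /(le_trans Ea); rewrite gE => h1.
  have := le_trans h1 (leeD2l (g s)%:E tail).
  by rewrite -EFinD lee_fin; lra.
have gs0 : 0 < g s by lra.
pose t := h / (3 * r).
have t3r : t * (3 * r) = h by rewrite /t divfK// gt_eqF// mulr_gt0.
have t0 : 0 < t by rewrite divr_gt0// mulr_gt0.
have t01 : 0 < t < 1.
  by rewrite t0 ltr_pdivrMr ?mulr_gt0//; lra.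
pose S := N `|` (E `&` B (s + h)).
have mS : measurable S by exact: measurableU.
have Er (x : 'rV[R]_d) j : (E `&` B s) x -> `|x ord0 j| <= s + enorm x0.
  move=> [_ xs]; apply: le_trans (le_coord_enorm x j) _.
  by rewrite -{1}(subrK x0 x) (le_trans (enormD _ _))// lerD2r.
have ES (x y : 'rV[R]_d) : (E `&` B s) x -> (forall j, `|y ord0 j| <= 1) ->
    S ((1 - t) *: x + t *: y).
  move=> [Ex xs] /yL yL'; set z := _ + _.
  have zx : enorm (z - x) <= h.
    rewrite (_ : z - x = t *: (y - x)); last first.
      by apply/rowP => j; rewrite !mxE; ring.
    rewrite enormZ gtr0_norm// -t3r ler_pM2l//.
    apply: le_trans (enorm_triangle _ x0 _) _; rewrite (enormB x0).
    by move: xs; rewrite /B /=; lra.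
  have [Ez|nEz] := pselect (E z); last by left; exact: EN nEz zx.
  right; split => //; rewrite /B /=.
  by apply: le_trans (enorm_triangle _ x _) _; rewrite addrC lerD.
have := cube_expansion c_radial c_cost V_cont mu_density V_defect p0 Vv mW W1 WC
  cW t01 (mEB s) mS Er ES gs0 (gE s).
set Q := 2 / p * ln C + v - d%:R * ln 2 in LaQ *.
have Sle : (mu S <= mu N + (g (s + h))%:E)%E by rewrite -gE; exact: measureU2.
move=> /le_trans/(_ Sle).
have -> : mu N = (fine (mu N))%:E by rewrite fineK// finm.
rewrite -EFinD !lee_fin => main.
have lngs : ln (1 / a) <= ln (1 / g s).
  rewrite ler_ln ?posrE ?divr_gt0// ler_pM2l// lef_pV2 ?posrE//; exact: ga.
have p23 : 2 / p <= 2 / 3 by rewrite ler_pM2l// lef_pV2 ?posrE.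
have br : ln (1 / a) / 6 <= (1 - 2 / p) * ln (1 / g s) - Q.
  have : 3^-1 * ln (1 / a) <= (1 - 2 / p) * ln (1 / g s).
    by apply: ler_pM => //; lra.
  by move: LaQ; lra.
have gain : t * (a / 4 * (ln (1 / a) / 6)) <=
    t * (g s * ((1 - 2 / p) * ln (1 / g s) - Q)).
  rewrite ler_pM2l//; apply: ler_pM => //; lra.
have tE : t * (a / 4 * (ln (1 / a) / 6)) = (a * h / r) * (ln (1 / a) / 72).
  by rewrite /t; field; rewrite gt_eqF.
have ahr : 0 < a * h / r by rewrite divr_gt0// mulr_gt0.
have l144 : (a * h / r) * 2 <= (a * h / r) * (ln (1 / a) / 144).
  by rewrite ler_pM2l//; lra.
rewrite (_ : h * (a * ln (1 / a) / (144 * r)) =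
  (a * h / r) * (ln (1 / a) / 144)); last by field; rewrite gt_eqF.
set X := a * h / r in ahr l144 tE *.
have am' : a / m%:R <= X * 2 by rewrite (le_trans am)// /X; lra.
set G := (1 - 2 / p) * ln (1 / g s) - Q in gain main *.
have mainE : g s * (1 + t * G) = g s + t * (g s * G) by ring.
move: main; rewrite mainE; lra.
Qed.

End gain.

(** * Tails and Minkowski content *)

Lemma measurable_expR_psi (R : realType) (d : nat) (psi : R -> R) (x0 : 'rV[R]_d) :
  (forall s t, 0 <= s -> s < t -> psi s < psi t) ->
  measurable_fun setT (fun x : 'rV[R]_d => (expR (psi (enorm (x - x0))))%:E).
Proof.
move=> psi_incr; apply/measurable_EFinP; apply: measurableT_comp => //.
rewrite (_ : (fun x => _) = (psi \o (fun t => Num.max t 0)) \o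
    (fun x : 'rV[R]_d => enorm (x - x0))); last first.
  by apply/funext => x /=; rewrite max_l// enorm_ge0.
apply: measurableT_comp; last exact: measurable_enormB.
apply: nondecreasing_measurable => // s t st /=.
have : Num.max s 0 <= Num.max t 0 by rewrite ge_max !le_max st lexx orbT.
rewrite le_eqVlt => /predU1P[->//|/psi_incr h]; apply/ltW/h.
by rewrite le_max lexx orbT.
Qed.

(** Markov's inequality, using that the integral of [exp (psi |x - x0|)] over the
    complement of a large ball is less than [delta]. *)
Lemma exponential_tail (R : realType) (d : nat) (mu : probability 'rV[R]_d R)
    (psi : R -> R) (x0 : 'rV[R]_d) (K delta : R) :
  (forall s t, 0 <= s -> s < t -> psi s < psi t) ->
  (\int[mu]_x (expR (psi (enorm (x - x0))))%:E <= K%:E)%E -> 0 < delta ->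
  exists2 r0 : R, 0 < r0 & forall r, r0 <= r ->
    (mu [set x | (r < enorm (x - x0))%R] <= (delta * expR (- psi r))%:E)%E.
Proof.
move=> psi_incr psiK delta0.
pose f x := (expR (psi (enorm (x - x0))))%:E.
have psi_le s t : 0 <= s -> s <= t -> psi s <= psi t.
  by move=> s0; rewrite le_eqVlt => /predU1P[->//|/(psi_incr _ _ s0)/ltW].
have f0 x : (0 <= f x)%E by rewrite lee_fin expR_ge0.
have mf : measurable_fun setT f by exact: measurable_expR_psi.
pose F (i : nat) := [set x : 'rV[R]_d | enorm (x - x0) <= i%:R].
have mF i : measurable (F i) by exact: measurable_enorm_ball.
have ndF : nondecreasing_seq F.
  move=> i j ij; apply/subsetPset => x /= /le_trans; apply.
  by rewrite ler_nat.
have UF : \bigcup_i F i = setT.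
  apply/seteqP; split => // x _; exists (Num.truncn (enorm (x - x0))).+1 => //.
  by rewrite /F /= ltW// truncnS_gt.
have := @ge0_nondecreasing_set_cvg_integral _ _ _ F f mu ndF mF
  (fun i => measurable_funTS mf) (fun i x _ => f0 x).
rewrite UF; set J := (\int[mu]_x f x)%E => FJ.
have Jfin : J \is a fin_num.
  rewrite ge0_fin_numE; last exact: integral_ge0.
  by rewrite (le_lt_trans psiK)// ltry.
have [n nJ] : exists n, (J - delta%:E < \int[mu]_(x in F n) f x)%E.
  have JJ : (J - delta%:E < J)%E.
    by rewrite lteBlDr// lteDl.
  have := FJ [set z | (J - delta%:E < z)%E].
  case.
    by apply: open_nbhs_nbhs; split => //; exact: open_ereal_gt_ereal.
  by move=> n _ /(_ n (leqnn n)) nJ; exists n.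
exists n.+1%:R => // r nr.
pose T := [set x : 'rV[R]_d | (r < enorm (x - x0))%R].
have TE : T = ~` [set x : 'rV[R]_d | enorm (x - x0) <= r].
  by apply/seteqP; split => x /=; rewrite /T /= ltNge; [move/negP|move=> /negP].
have mT : measurable T by rewrite TE; apply: measurableC; exact: measurable_enorm_ball.
have r0 : 0 <= r by apply: le_trans nr.
have TF : (\int[mu]_(x in F n) f x + \int[mu]_(x in T) f x <= J)%E.
  rewrite -ge0_integral_setU//.
  - by apply: ge0_subset_integral => //; exact: measurableU.
  - exact: measurable_funTS.
  - apply/disj_setPS => x [/= xn]; rewrite /T /= => /(le_lt_trans nr).
    by rewrite ltNge (le_trans xn)// ler_nat.
have Tpsi : ((expR (psi r))%:E * mu T <= \int[mu]_(x in T) f x)%E.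
  rewrite -integral_cst//; apply: ge0_le_integral => //.
  - by move=> x _; rewrite lee_fin expR_ge0.
  - exact: measurable_funTS.
  by move=> x /= rx; rewrite lee_fin ler_expR psi_le// ltW.
have muT : mu T = (fine (mu T))%:E by rewrite fineK// fin_num_measure.
have Ifin (B : set 'rV[R]_d) : measurable B -> (\int[mu]_(x in B) f x)%E \is a fin_num.
  move=> mB; rewrite ge0_fin_numE; last exact: integral_ge0.
  apply: le_lt_trans (_ : J < +oo)%E; last by rewrite ltey_eq Jfin.
  exact: ge0_subset_integral.
move: TF Tpsi nJ; rewrite -/T muT.
rewrite -(fineK (Ifin _ (mF n))) -(fineK (Ifin _ mT)) -(fineK Jfin).
rewrite -EFinD -EFinB -EFinM !lee_fin lte_fin => TF Tpsi nJ.
rewrite expRN ler_pdivlMr ?expR_gt0// mulrC.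
by apply: le_trans Tpsi _; lra.
Qed.

Lemma minkowski_content_ge (R : realType) (d : nat)
    (mu : set 'rV[R]_d -> \bar R) (A : set 'rV[R]_d) (b h0 : R) : 0 < h0 ->
  (forall h, 0 < h -> h <= h0 ->
    ((h * b)%:E <= mu [set x | ~ A x /\ (edist_set x A <= h%:E)%E])%E) ->
  (b%:E <= minkowski_content mu A)%E.
Proof.
move=> h00 hb; rewrite /minkowski_content limf_einfE.
apply: le_ereal_sup_tmp.
have V0 : 0^'+ ([set h | 0 < h] `&` [set h | h <= h0]).
  by apply: filterI; [exact: nbhs_right_gt|exact: nbhs_right_le].
eexists; first by eexists; first exact: V0.
apply: le_ereal_inf_tmp => _ [h /= [h1 h2] <-].
have -> : b%:E = ((h^-1)%:E * (h * b)%:E)%E.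
  by rewrite -EFinM mulKf// gt_eqF.
by rewrite lee_pmul2l ?lte_fin ?invr_gt0//; exact: hb.
Qed.

(** * Isoperimetric inequality *)

Theorem theorem5p11 (R : realType) (d : nat)
    (ctilde : R -> R) (c : 'rV[R]_d -> R)
    (V : 'rV[R]_d -> R) (mu : probability 'rV[R]_d R)
    (eps : R) (psi : R -> R) (x0 : 'rV[R]_d) (K : R)
    (c_radial : forall x, c x = ctilde (enorm x))
    (c_cost : (forall x, c x = 0) \/
      [/\ cost_function c, strictly_convex c & superlinear c])
    (V_diff : forall x, differentiable V x)
    (mu_density : forall A : set 'rV[R]_d, measurable A ->
      mu A = (\int[lebesgue_rV R d]_(x in A) (expR (- V x))%:E)%E)
    (V_defect : forall x y, convexity_defect V x y <= c (x - y))
    (eps_gt0 : 0 < eps)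
    (c_integrable : (mu \x mu)%E.-integrable
      [set: 'rV[R]_d * 'rV[R]_d]
      (fun z => (expR ((3 + eps) * c (z.1 - z.2)))%:E))
    (psi_ge0 : forall t, 0 <= t -> 0 <= psi t)
    (psi_incr : forall s t, 0 <= s -> s < t -> psi s < psi t)
    (psi_moment :
      (\int[mu]_x (expR (psi (enorm (x - x0))))%:E <= K%:E)%E) :
  exists D a0 : R, [/\ 0 < D, 0 < a0 &
    forall A : set 'rV[R]_d, measurable A ->
      let a : R := fine (mine (mu A) (mu (~` A))) in
      0 < a <= a0 ->
      (a%:E * ((ln (1 / a))%:E / generalized_inverse psi (ln (K / a)))
        <= D%:E * minkowski_content mu A)%E].
Proof.
have V_cont : continuous V by move=> x; exact: differentiable_continuous.
pose p := 3 + eps.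
have p3 : 3 <= p by rewrite lerDl ltW.
have p0 : 0 < p by lra.
have [W [C [mW W1 WC cW]]] :=
  cost_weight c_radial c_cost V_cont mu_density ltr01 p0 c_integrable.
have [v Vv] := continuous_box_bounded 1 V_cont.
pose L := enorm (const_mx 1 : 'rV[R]_d) + enorm x0.
have yL (y : 'rV[R]_d) : (forall j, `|y ord0 j| <= 1) -> enorm (y - x0) <= L.
  move=> y1; rewrite (le_trans (enormD _ _))// enormN lerD2r.
  by apply: le_enorm => j; rewrite mxE normr1.
have K1 : 1 <= K.
  rewrite -lee_fin; apply: le_trans psi_moment.
  have <- : (\int[mu]_x 1 = 1)%E.
    by rewrite integral_cst//= mul1e ?probability_setT.
  apply: ge0_le_integral => //; first exact: measurable_expR_psi.
  by move=> x _; rewrite lee_fin -expR0 ler_expR psi_ge0// enorm_ge0.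
have K40 : 0 < K / 4 by rewrite divr_gt0// (lt_le_trans ltr01).
have [R1 R10 tail] := exponential_tail psi_incr psi_moment K40.
pose R2 := R1 + L.
have R20 : 0 < R2 by rewrite ltr_wpDr// addr_ge0 ?enorm_ge0.
pose Q := 2 / p * ln C + v - d%:R * ln 2.
(* 288 and 6 Q absorb the error terms; psi R2 makes psi^-1 (ln (K / a)) >= R2 *)
pose X := Num.max 288 (Num.max (6 * Q) (psi R2)).
exists 288, (expR (- X)); split => //; first exact: expR_gt0.
move=> A mA a /andP[a0 aX].
have aE : a = fine (mine (mu A) (mu (~` A))) by [].
clearbody a.
have La : X <= ln (1 / a).
  by rewrite div1r lnV// lerNr -(expRK (- X)) ler_ln// posrE expR_gt0.
move: La; rewrite /X !ge_max => /and3P[La288 LaQ Lapsi].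
have finm (B : set 'rV[R]_d) : measurable B -> mu B = (fine (mu B))%:E.
  by move=> mB; rewrite fineK// fin_num_measure.
have lnKa : ln (K / a) = ln K + ln (1 / a).
  by rewrite -lnM ?posrE ?divr_gt0// ?(lt_le_trans ltr01 K1)// mul1r.
have lnK0 : 0 <= ln K by exact: ln_ge0.
set rho := generalized_inverse psi (ln (K / a)).
have R2rho : (R2%:E <= rho)%E.
  apply: ereal_sup_ubound; exists R2 => //=; split; first exact: ltW.
  by rewrite lnKa; lra.
have cont0 : (0 <= minkowski_content mu A)%E.
  apply: (@minkowski_content_ge _ _ _ _ 0 1) => // h h0 _.
  by rewrite mulr0.
(* a bounded psi may give +oo, and then the left-hand side vanishes *)
have [rhoy|rhoNy] := eqVneq rho +oo%E.
  by rewrite rhoy invey !mule0 mule_ge0.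
have rhofin : rho \is a fin_num.
  by rewrite fin_numE rhoNy andbT gt_eqF// (lt_le_trans _ R2rho)// ltNyr.
set r0 := fine rho; have rhoE : rho = r0%:E by rewrite fineK.
have R2r0 : R2 <= r0 by rewrite -lee_fin -rhoE.
have r00 : 0 < r0 by exact: lt_le_trans R2r0.
pose r := 2 * r0.
have psir : ln (K / a) < psi r.
  rewrite ltNge; apply/negP => h.
  have : (r%:E <= rho)%E.
    by apply: ereal_sup_ubound; exists r => //; split=> //; rewrite /r; lra.
  by rewrite rhoE lee_fin /r; lra.
have L0 : 0 <= L by rewrite addr_ge0 ?enorm_ge0.
have r0' : 0 < r by rewrite mulr_gt0.
have Lr : L <= r by rewrite /r; move: R2r0; rewrite /R2; lra.
have tail_r : (mu [set x | (r < enorm (x - x0))%R] <= (a / 4)%:E)%E.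
  apply: le_trans (tail r _) _; first by rewrite /r; move: R2r0; rewrite /R2; lra.
  have K0 : 0 < K by exact: lt_le_trans K1.
  have : expR (- psi r) <= a / K.
    rewrite -[leRHS]invf_div -[K / a]lnK ?posrE ?divr_gt0// -expRN ler_expR.
    by rewrite lerN2 ltW.
  rewrite ler_pdivlMr// lee_fin; lra.
pose b := a * ln (1 / a) / (144 * r).
have b0 : 0 < b by rewrite divr_gt0 ?mulr_gt0//; lra.
suff bmink : (b%:E <= minkowski_content mu A)%E.
  rewrite rhoE inver gt_eqF// -!EFinM.
  apply: (@le_trans _ _ (288%:E * b%:E)%E); last exact: lee_wpmul2l.
  rewrite -EFinM lee_fin /b /r le_eqVlt; apply/orP; left; apply/eqP.
  by field; rewrite gt_eqF.
pose h1 := Num.min r0 (a / (2 * b)).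
have h10 : 0 < h1 by rewrite lt_min r00 divr_gt0// mulr_gt0.
apply: (minkowski_content_ge h10) => h h0; rewrite le_min => /andP[hr hb].
pose N := [set x | ~ A x /\ (edist_set x A <= h%:E)%E].
have mN : measurable N.
  apply: measurableI; first exact: measurableC.
  exact: measurable_edist_set.
have hr2 : h <= r / 2 by rewrite /r; lra.
have gain := neighbourhood_gain c_radial c_cost V_cont mu_density V_defect p3 Vv
  mW W1 WC cW yL r0' Lr a0 La288 LaQ tail_r.
have mAC : measurable (~` A) by exact: measurableC.
move: aE; case: (leP (mu A) (mu (~` A))) => _ aE.
  have muA : mu A = a%:E by rewrite aE -finm.
  apply: (gain h A N) => //.
  - by rewrite muA lee_fin; lra.
  - by rewrite muA.
  move=> x z Ax nAz xz; split => //.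
  by apply: le_trans (edist_set_le z Ax) _; rewrite lee_fin.
have muA : mu (~` A) = a%:E by rewrite aE -finm.
pose E := ~` [set x | (edist_set x A <= h%:E)%E].
have mE : measurable E by apply: measurableC; exact: measurable_edist_set.
have EA : E `<=` ~` A.
  move=> x Ex Ax; apply: Ex; rewrite /=.
  by apply: le_trans (edist_set_le x Ax) _; rewrite subrr enorm0 lee_fin ltW.
(* if E loses half of the mass, the neighbourhood of A has measure a / 2 at once *)
have [aE2|Ea2] := leP (a / 2)%:E (mu E).
  apply: (gain h E N) => //.
  - by rewrite -muA le_measure ?inE.
  move=> x z Ex nEz xz; split; last exact: contrapT.
  move=> Az; apply: Ex; apply: le_trans (edist_set_le x Az) _.
  by rewrite enormB lee_fin.
have : (mu (~` A) <= mu N + mu E)%E.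
  apply: le_trans (measureU2 _ _ _) => //; apply: le_measure; rewrite ?inE//.
    exact: measurableU.
  by move=> x nAx; have [Ex|nEx] := pselect (E x); [right|left; split => //; exact: contrapT].
move: Ea2; rewrite muA (finm _ mE) (finm _ mN) -EFinD !lee_fin lte_fin => Ea2 aNE.
apply: (@le_trans _ _ (a / 2)); last lra.
rewrite ler_pdivlMr// -mulrA (mulrC b).
by move: hb; rewrite ler_pdivlMr// mulr_gt0.
Qed.
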